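(* Let $X$ be a topological space. The following are equivalent: 1. $X$ is coherent and weakly Hausdorff; 2. $\mathcal{Q}_v(X)$ is coherent and weakly Hausdorff; 3. $\mathcal{Q}^*_v(X)$ is coherent and weakly Hausdorff.
   Context: For a topological space $X$, the specialization preorder is: $x\le_{\mathrm{spec}} y$ iff $x\in \mathrm{cl}(\{y\})$. A subset of $X$ is saturated if it is an intersection of open subsets of $X$ (equivalently, upward closed for $\le_{\mathrm{spec}}$). No separation is included in compactness, and the empty set counts as a compact saturated set. $X$ is coherent if the intersection of any two compact saturated subsets of $X$ is again compact saturated. $X$ is weakly Hausdorff if for all compact saturated subsets $Q_1,Q_2$ of $X$ and every open set $W\supseteq Q_1\cap Q_2$ there are open sets $U\supseteq Q_1$ and $V\supseteq Q_2$ with $U\cap V\subseteq W$. $\mathcal{Q}(X)$ denotes the set of all compact saturated subsets of $X$ (including $\varnothing$). The upper Vietoris topology on $\mathcal{Q}(X)$ is the topology generated by the basic open sets $\square U:=\{K\in\mathcal{Q}(X): K\subseteq U\}$, $U$ ranging over the open subsets of $X$. $\mathcal{Q}_v(X)$ is $\mathcal{Q}(X)$ with this topology, and $\mathcal{Q}^*_v(X)$ is its subspace consisting of the nonempty compact saturated subsets of $X$. *)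

(* Defs.v *)
From HB Require Import structures.
From mathcomp Require Import all_boot all_order all_classical.
From mathcomp Require Import topology.

Set Implicit Arguments.
Unset Strict Implicit.
Unset Printing Implicit Defensive.

Local Open Scope classical_set_scope.

(* [F] may be empty, so that [setT] is saturated. *)
Definition saturated (X : topologicalType) (A : set X) : Prop :=
  exists2 F : set (set X), F `<=` open & A = \bigcap_(U in F) U.

Definition compact_saturated (X : topologicalType) : set (set X) :=
  [set K | compact K /\ saturated K].

Definition coherent (X : topologicalType) : Prop :=
  forall Q1 Q2 : set X, compact_saturated Q1 -> compact_saturated Q2 ->
    compact_saturated (Q1 `&` Q2).

Definition weakly_Hausdorff (X : topologicalType) : Prop :=
  forall Q1 Q2 W : set X, compact_saturated Q1 -> compact_saturated Q2 ->
    open W -> Q1 `&` Q2 `<=` W ->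
    exists U V : set X,
      [/\ open U, open V, Q1 `<=` U, Q2 `<=` V & U `&` V `<=` W].

Definition Qv (X : topologicalType) : Type := set_type (@compact_saturated X).

HB.instance Definition _ (X : topologicalType) :=
  Choice.copy (Qv X) (set_type (@compact_saturated X)).

Definition Qbox (X : topologicalType) (U : set X) : set (Qv X) :=
  [set K | set_val K `<=` U].

Lemma Qbox_cover (X : topologicalType) :
  \bigcup_(U in @open X) Qbox U = setT.
Proof. by apply/seteqP; split=> // K _; exists setT => //; exact: openT. Qed.

Lemma Qbox_join (X : topologicalType) (U V : set X) (K : Qv X) :
  open U -> open V -> Qbox U K -> Qbox V K ->
  exists W, [/\ open W, Qbox W K & Qbox W `<=` Qbox U `&` Qbox V].
Proof.
move=> oU oV KU KV; exists (U `&` V); split; first exact: openI.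
- by move=> x Kx; split; [exact: KU | exact: KV].
- by move=> L LUV; split=> x /LUV[].
Qed.

HB.instance Definition _ (X : topologicalType) :=
  isBaseTopological.Build (Qv X) (@Qbox_cover X) (@Qbox_join X).

(* [set_type] carries the subspace topology. *)
Definition Qvstar (X : topologicalType) : Type :=
  set_type [set K : Qv X | set_val K !=set0].

HB.instance Definition _ (X : topologicalType) :=
  Topological.copy (Qvstar X) (set_type [set K : Qv X | set_val K !=set0]).

(* Main.v *)
Require Import Defs.
From mathcomp Require Import all_boot all_order all_classical.
From mathcomp Require Import topology.

(** Write [Q] for [Qv X] and [Q*] for [Qvstar X].  The specialization order of
both is reverse inclusion ([spec_le_Qv], [spec_le_Qvstar]), so a saturated
family of compact saturated sets is one that is closed under passing to smaller
compact saturated sets.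

From [X] to [Q].  Coherence of [X] makes intersection an operation [Qcap] from
[Q * Q] to [Q], and weak Hausdorffness of [X] says exactly that this operation
is continuous.  If [C] and [D] are compact saturated in [Q], then their
intersection is the image of [C `*` D] under [Qcap], because saturated families
absorb intersections; a continuous image of a compact product is compact, so
[Q] is coherent.  If moreover [C `&` D `<=` W] with [W] open, then [C `*` D]
lies in the open preimage of [W], and the tube lemma [compact_tubeX] puts an
open box [U `*` V] around it inside that preimage.  Since [Qcap (K, K) = K],
the sets [U] and [V] separate [C] from [D] relatively to [W].

From [Q] to [Q*].  The complement of [Q*] in [Q] is the open set [Qbox set0],
and both properties pass to closed subspaces: replace each compact saturated
subset of the subspace by its upward closure in the ambient space, which is
compact saturated there and has the same trace on the subspace, and enlarge an
open set by the open complement of the subspace.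

From [Q*] to [X].  A nonempty compact saturated [K] generates the principal
upset of [Q*] made of the nonempty compact saturated subsets of [K], and
principal upsets are compact saturated.  A point [x] belongs to [K] iff its own
upset, seen as a point of [Q*], lies in the principal upset of [K].  Separation
in [Q*] thus restricts to separation in [X], and [K `&` L] is the union of a
compact family of compact sets, hence compact ([compact_bigcup_Qv]). *)

Set Implicit Arguments.
Unset Strict Implicit.
Unset Printing Implicit Defensive.

Local Open Scope classical_set_scope.

(** * The tube lemma *)

(** Tube lemma with one factor replaced by an arbitrary filter.  Compactness
in the form [near_covering] only yields that, eventually in the index, every
point of [A] satisfies [P].  The stronger conclusion, with an open set around
[A], follows by letting the index be a set [J] that shrinks along [F] and asking
each point of [A] to be interior to the set of points good for all of [J]. *)
Lemma compact_tube (X : topologicalType) (A : set X) I (F : set_system I)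
    (P : set (X * I)) :
  Filter F -> compact A -> (forall x, A x -> filter_prod (nbhs x) F P) ->
  exists U J, [/\ open U, A `<=` U, F J & U `*` J `<=` P].
Proof.
move=> FF /compact_near_coveringP cA AP.
pose S (J : set I) := [set x | forall i, J i -> P (x, i)].
pose G := filter_from F (fun J => [set J' | J' `<=` J]).
have FG : Filter G.
  apply: filter_from_filter; first by exists setT; exact: filterT.
  move=> J K FJ FK; exists (J `&` K); first exact: filterI.
  by move=> L LJK; split=> i /LJK[].
have [|J FJ AJ] := cA _ G (fun J => (S J)°) FG.
  move=> x Ax; have [[U J] /= [Ux FJ] UJ] := AP x Ax.
  exists (U°, [set J' | J' `<=` J]) => /=.
    by split; [exact: nbhs_interior | exists J].
  move=> [y J'] /= [Uy J'J]; apply: filterS Uy => z Uz i /J'J Ji.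
  exact: (UJ (z, i)).
exists (S J)°, J; split=> //; first exact: open_interior.
  exact: AJ.
by move=> [x i] [/= /interior_subset Sx /Sx].
Qed.

(** Two uses of [compact_tube]: along [B] with the neighbourhood filter of a
point of [A], then along [A] with the filter of neighbourhoods of [B]. *)
Lemma compact_tubeX (X Y : topologicalType) (A : set X) (B : set Y)
    (W : set (X * Y)) :
  compact A -> compact B -> open W -> A `*` B `<=` W ->
  exists U V, [/\ open U, open V, A `<=` U, B `<=` V & U `*` V `<=` W].
Proof.
move=> cA cB oW ABW.
have [x Ax|U [J [oU AU /set_nbhsP[V [oV BV VJ]] UJ]]] :=
    @compact_tube _ A _ (set_nbhs B) W _ cA.
  have [y By|V [J [oV BV Jx VJ]]] :=
      @compact_tube _ B _ (nbhs x) [set p | W (p.2, p.1)] _ cB.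
    have [[M N] /= [Mx Ny] MN] : nbhs (x, y) W.
      by apply: open_nbhs_nbhs; split=> //; exact: ABW.
    by exists (N, M) => // -[y' x'] /= [Ny' Mx']; exact: (MN (x', y')).
  exists (J, V); first by split=> //=; apply/set_nbhsP; exists V; split.
  by move=> [x' y'] /= [Jx' Vy']; exact: (VJ (y', x')).
exists U, V; split=> // -[x y] [/= Ux /VJ Jy]; exact: (UJ (x, y)).
Qed.

(** * The specialization preorder *)

Definition spec_le (X : topologicalType) (x y : X) := closure [set y] x.

Lemma spec_leP (X : topologicalType) (x y : X) :
  spec_le x y <-> forall U, open U -> U x -> U y.
Proof.
split=> [xy U oU Ux|xy U].
  by have [_ [->]] := xy U (open_nbhs_nbhs (conj oU Ux)).
by rewrite nbhsE => -[V [oV /(xy _ oV) Vy] VU]; exists y; split=> //; exact: VU.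
Qed.

Lemma spec_le_refl (X : topologicalType) (x : X) : spec_le x x.
Proof. exact: subset_closure. Qed.
(* Unfolding [spec_le] would otherwise make [x] implicit. *)
Arguments spec_le_refl {X} x.

Lemma spec_le_trans (X : topologicalType) (y x z : X) :
  spec_le x y -> spec_le y z -> spec_le x z.
Proof.
move=> /spec_leP xy /spec_leP yz; apply/spec_leP => U oU.
by move=> /(xy U oU)/(yz U oU).
Qed.

Lemma saturatedP (X : topologicalType) (A : set X) :
  saturated A <-> forall x y, spec_le x y -> A x -> A y.
Proof.
split=> [[F oF ->] x y /spec_leP xy Fx U FU|upA].
  by apply: xy (Fx U FU); exact: oF.
exists [set U | open U /\ A `<=` U]; first by move=> U [].
apply/seteqP; split=> [x Ax U [_]|y Ay]; first exact.
apply: contrapT => nAy.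
have : (~` closure [set y]) y.
  apply: Ay; split=> [|x Ax xy]; last exact: nAy (upA _ _ xy Ax).
  by apply: closed_openC; exact: closed_closure.
by apply; exact: subset_closure.
Qed.

Lemma saturatedI (X : topologicalType) (A B : set X) :
  saturated A -> saturated B -> saturated (A `&` B).
Proof.
move=> /saturatedP uA /saturatedP uB; apply/saturatedP => x y xy [Ax Bx].
by split; [exact: uA Ax|exact: uB Bx].
Qed.

Lemma saturated_open (X : topologicalType) (U : set X) : open U -> saturated U.
Proof. by move=> oU; apply/saturatedP => x y /spec_leP; apply. Qed.

Definition upset (X : topologicalType) (A : set X) :=
  [set y | exists2 x, A x & spec_le x y].

Lemma sub_upset (X : topologicalType) (A : set X) : A `<=` upset A.
Proof. by move=> x Ax; exists x => //; exact: spec_le_refl. Qed.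

(** An open set that contains [A] contains its upward closure, so the two have
the same open covers. *)
Lemma compact_saturated_upset (X : topologicalType) (A : set X) :
  compact A -> compact_saturated (upset A).
Proof.
move=> cA; split; last first.
  apply/saturatedP => y z yz [x Ax xy]; exists x => //; exact: spec_le_trans yz.
apply/compact_near_coveringP => I F P FF cover.
have [x Ax|U [J [oU AU FJ UJ]]] :=
    @compact_tube _ A _ F [set p | P p.2 p.1] _ cA.
  by apply: cover; exact: sub_upset.
apply: filterS FJ => i Ji y [x /AU Ux /spec_leP xy].
exact: (UJ (y, i) (conj (xy U oU Ux) Ji)).
Qed.

Lemma compact_saturated_spec_le (X : topologicalType) (x : X) :
  compact_saturated (spec_le x).
Proof.
have <- : upset [set x] = spec_le x.
  by apply/seteqP; split=> [y [_ ->]|y xy] //; exists x.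
exact: compact_saturated_upset (@compact_set1 _ x).
Qed.

(** * Closed subspaces *)

Section subtype.
Variables (X : topologicalType) (A : set X).

Lemma compact_set_val (C : set (set_type A)) :
  compact (set_val @` C) <-> compact C.
Proof.
split=> cC; last first.
  apply: continuous_compact => //; apply: continuous_subspaceT.
  exact: initial_continuous.
move=> F PF FC.
have image_F M : F M -> (set_val @ F) (set_val @` M).
  by move=> FM; apply: (@filterS _ F _ M) FM => x Mx; exists x.
have [|_ [[x Cx <-] clx]] := cC (set_val @ F) (fmap_proper_filter _ PF).
  exact: image_F.
exists x; split=> // M N FM; rewrite nbhsE => -[_ [[O oO <-] Ox] ON].
have [||_ [[y My <-] Oy]] := clx (set_val @` M) O.
- exact: image_F.
- exact: open_nbhs_nbhs.
- by exists y; split=> //; exact: ON.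
Qed.

Lemma spec_le_set_val (x y : set_type A) :
  spec_le (set_val x) (set_val y) <-> spec_le x y.
Proof.
split=> /spec_leP xy; apply/spec_leP => U oU; last first.
  by apply: (xy (set_val @^-1` U)); exists U.
by case: oU => O oO <-; exact: xy.
Qed.

(** Going up in the ambient space and restricting again gives nothing new; this
lets the properties of the ambient space be applied to upward closures. *)
Lemma upset_set_val (C : set (set_type A)) : saturated C ->
  set_val @^-1` upset (set_val @` C) = C.
Proof.
move=> /saturatedP uC; apply/seteqP; split.
  by move=> y [_ [x Cx <-] /spec_le_set_val xy]; exact: uC Cx.
by move=> x Cx; apply: sub_upset; exists x.
Qed.

Lemma coherent_closed : closed A -> coherent X -> coherent (set_type A).
Proof.
move=> clA cohX C D [cC sC] [cD sD]; split; last exact: saturatedI.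
have cUC := compact_saturated_upset ((compact_set_val C).2 cC).
have cUD := compact_saturated_upset ((compact_set_val D).2 cD).
have [cUCD _] := cohX _ _ cUC cUD.
apply/compact_set_val; have := compact_closedI cUCD clA.
congr compact; apply/seteqP; split=> [x [[Cx Dx] Ax]|_ [x [Cx Dx] <-]].
  exists (SigSub (mem_set Ax)) => //.
  by split; [rewrite -(upset_set_val sC)|rewrite -(upset_set_val sD)].
split; last exact: set_mem (valP x).
by split; apply: sub_upset; exact: imageP.
Qed.

Lemma weakly_Hausdorff_closed :
  closed A -> weakly_Hausdorff X -> weakly_Hausdorff (set_type A).
Proof.
move=> clA wHX C D W [cC sC] [cD sD] [O oO OW] CDW.
have cUC := compact_saturated_upset ((compact_set_val C).2 cC).
have cUD := compact_saturated_upset ((compact_set_val D).2 cD).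
have oOA : open (O `|` ~` A) by apply: openU => //; exact: closed_openC.
have [|U [V [oU oV CU DV UV]]] := wHX _ _ _ cUC cUD oOA.
  move=> x [Cx Dx]; have [Ax|nAx] := pselect (A x); last by right.
  left; suff : W (SigSub (mem_set Ax)) by rewrite -OW.
  by apply: CDW; rewrite -(upset_set_val sC) -(upset_set_val sD).
exists (set_val @^-1` U), (set_val @^-1` V); split.
- by exists U.
- by exists V.
- by move=> x Cx; apply/CU/sub_upset; exact: imageP.
- by move=> x Dx; apply/DV/sub_upset; exact: imageP.
- by move=> x /UV; rewrite -OW => -[//|]; case; exact: set_mem (valP x).
Qed.

End subtype.

(** * The upper Vietoris topology *)

Definition Qpoint (X : topologicalType) (K : set X) (cK : compact_saturated K) :
  Qv X := SigSub (mem_set cK).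

Lemma QvP (X : topologicalType) (K : Qv X) : compact_saturated (set_val K).
Proof. exact: set_mem (valP K). Qed.

Lemma open_Qbox (X : topologicalType) (U : set X) : open U -> open (Qbox U).
Proof.
move=> oU; exists [set U]; first by move=> _ ->.
by rewrite bigcup_set1.
Qed.

Lemma open_QvP (X : topologicalType) (W : set (Qv X)) (K : Qv X) :
  open W -> W K -> exists U, [/\ open U, set_val K `<=` U & Qbox U `<=` W].
Proof.
move=> [D oD <-] [U DU KU]; exists U; split=> //; first exact: oD.
by move=> L LU; exists U.
Qed.

Lemma spec_le_Qv (X : topologicalType) (K L : Qv X) :
  spec_le K L <-> set_val L `<=` set_val K.
Proof.
split=> [/spec_leP KL|LK].
  have [_ [F oF KF]] := QvP K.
  rewrite KF => x Lx U FU; have oU := oF U FU.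
  apply: (KL _ (open_Qbox oU)) Lx.
  by rewrite /Qbox /= KF => y; exact.
apply/spec_leP => W oW /(open_QvP oW)[U [oU KU]]; apply.
exact: subset_trans KU.
Qed.

(** A covering of the union is a covering of each member [K]; by the tube lemma
it works uniformly on an open [U] around [K], that is, on the neighbourhood
[Qbox U] of [K], so compactness of the family applies. *)
Lemma compact_bigcup_Qv (X : topologicalType) (C : set (Qv X)) :
  compact C -> compact (\bigcup_(K in C) set_val K).
Proof.
move=> /compact_near_coveringP cC.
apply/compact_near_coveringP => I F P FF cover.
suff : \forall i \near F, C `<=` [set K | set_val K `<=` P i].
  by apply: filterS => i CP x [K CK Kx]; exact: CP Kx.
apply: cC => K CK.
have [x Kx|U [J [oU KU FJ UJ]]] :=
    @compact_tube _ (set_val K) _ F [set p | P p.2 p.1] _ (QvP K).1.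
  by apply: cover; exists K.
exists (Qbox U, J).
  split=> //=; apply: open_nbhs_nbhs; split=> //; exact: open_Qbox.
by move=> [L i] [/= LU Ji] x /LU Ux; exact: (UJ (x, i)).
Qed.

(** * Intersection as a continuous operation *)

Section Qcap.
Variables (X : topologicalType) (cohX : coherent X) (wHX : weakly_Hausdorff X).

Definition Qcap (p : Qv X * Qv X) : Qv X :=
  Qpoint (cohX (QvP p.1) (QvP p.2)).

Lemma continuous_Qcap : continuous Qcap.
Proof.
move=> [K L] N; rewrite nbhsE => -[W [oW WKL] WN].
have [U [oU KLU UW]] := open_QvP oW WKL.
have [A [B [oA oB KA LB ABU]]] := wHX (QvP K) (QvP L) oU KLU.
exists (Qbox A, Qbox B).
  by split; apply: open_nbhs_nbhs; split=> //; exact: open_Qbox.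
move=> [K' L'] [/= K'A L'B]; apply/WN/UW => x [/= /K'A Ax /L'B Bx].
exact: ABU.
Qed.

(** From left to right, [K] is [Qcap (K, K)]; from right to left, [Qcap (K, L)]
is above both [K] and [L] in the specialization order. *)
Lemma Qcap_image (C D : set (Qv X)) : saturated C -> saturated D ->
  C `&` D = Qcap @` (C `*` D).
Proof.
move=> /saturatedP uC /saturatedP uD; apply/seteqP; split.
  move=> K [CK DK]; exists (K, K) => //; apply: val_inj; exact: setIid.
move=> _ [[K L] [/= CK DL] <-]; split.
  apply: uC CK; apply/spec_le_Qv; exact: subIsetl.
by apply: uD DL; apply/spec_le_Qv; exact: subIsetr.
Qed.

Lemma coherent_Qv : coherent (Qv X).
Proof.
move=> C D [cC sC] [cD sD]; split; last exact: saturatedI.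
rewrite (Qcap_image sC sD); apply: continuous_compact.
  apply: continuous_subspaceT; exact: continuous_Qcap.
exact: compact_setX.
Qed.

Lemma weakly_Hausdorff_Qv : weakly_Hausdorff (Qv X).
Proof.
move=> C D W [cC sC] [cD sD] oW CDW.
have oW' : open (Qcap @^-1` W)
  by apply: open_comp oW => p _; exact: continuous_Qcap.
have [|U [V [oU oV CU DV UVW]]] := compact_tubeX cC cD oW'.
  by move=> p CDp; apply: CDW; rewrite (Qcap_image sC sD); exact: imageP.
exists U, V; split=> // K [UK VK].
suff <- : Qcap (K, K) = K by exact: (UVW (K, K)).
apply: val_inj; exact: setIid.
Qed.

End Qcap.

(** * The space of nonempty compact saturated sets *)

Lemma closed_Qvstar (X : topologicalType) :
  closed [set K : Qv X | set_val K !=set0].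
Proof.
rewrite -openC (_ : ~` _ = Qbox set0); first exact/open_Qbox/open0.
by apply/seteqP; split=> K; rewrite /Qbox /= subset0 => /nonemptyPn.
Qed.

Definition Qstar_point (X : topologicalType) (K : set X)
    (cK : compact_saturated K) (K0 : K !=set0) : Qvstar X :=
  SigSub (mem_set (K0 : [set K : Qv X | set_val K !=set0] (Qpoint cK))).

(** The canonical map from [X] to [Qvstar X]: by [Qstar_up_sub], pulling the
basic open set of an open [U] back along it gives [U] itself. *)
Definition Qstar_up (X : topologicalType) (x : X) : Qvstar X :=
  Qstar_point (compact_saturated_spec_le x) (ex_intro _ x (spec_le_refl x)).

Lemma spec_le_Qvstar (X : topologicalType) (K L : Qvstar X) :
  spec_le K L <-> set_val (set_val L) `<=` set_val (set_val K).
Proof.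
by apply: iff_trans (spec_le_Qv _ _); apply: iff_sym; exact: spec_le_set_val.
Qed.

Lemma open_QvstarP (X : topologicalType) (W : set (Qvstar X)) (K : Qvstar X) :
  open W -> W K -> exists U, [/\ open U, set_val (set_val K) `<=` U &
    set_val @^-1` Qbox U `<=` W].
Proof.
move=> [O oO <-] /(open_QvP oO)[U [oU KU UO]]; exists U; split=> // L.
exact: UO.
Qed.

Lemma Qstar_up_sub (X : topologicalType) (A : set X) (x : X) : saturated A ->
  set_val (set_val (Qstar_up x)) `<=` A <-> A x.
Proof.
move=> /saturatedP uA; split; first by apply; exact: spec_le_refl.
by move=> Ax y xy; exact: uA Ax.
Qed.

(** [K `&` L] is the union of the members of the intersection of the principal
upsets of [K] and [L], the member [Qstar_up x] witnessing that a common point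
[x] is covered. *)
Lemma coherent_of_Qvstar (X : topologicalType) :
  coherent (Qvstar X) -> coherent X.
Proof.
move=> cohQ K L cK cL; split; last exact: saturatedI cK.2 cL.2.
(* The empty set is not a point of [Qvstar X]. *)
have [K0|/set0P K0] := eqVneq K set0.
  by rewrite K0 set0I; exact: compact0.
have [L0|/set0P L0] := eqVneq L set0.
  by rewrite L0 setI0; exact: compact0.
have [+ _] := cohQ _ _ (compact_saturated_spec_le (Qstar_point cK K0))
                    (compact_saturated_spec_le (Qstar_point cL L0)).
move=> /compact_set_val/compact_bigcup_Qv; congr compact.
apply/seteqP; split.
  move=> x [_ [M [/spec_le_Qvstar MK /spec_le_Qvstar ML] <-] Mx].
  by split; [exact: MK|exact: ML].
move=> x [Kx Lx]; exists (set_val (Qstar_up x)); last exact: spec_le_refl.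
exists (Qstar_up x) => //; split; apply/spec_le_Qvstar.
  by apply/Qstar_up_sub => //; exact: cK.2.
by apply/Qstar_up_sub => //; exact: cL.2.
Qed.

(** Opens separating the principal upsets of [K] and [L] may be shrunk to basic
ones around the points [K] and [L]; pulled back along [Qstar_up] these are
open sets of [X]. *)
Lemma weakly_Hausdorff_of_Qvstar (X : topologicalType) :
  weakly_Hausdorff (Qvstar X) -> weakly_Hausdorff X.
Proof.
move=> wHQ K L W cK cL oW KLW.
have [K0|/set0P K0] := eqVneq K set0.
  exists set0, setT; rewrite K0 set0I.
  by split=> //; [exact: open0|exact: openT].
have [L0|/set0P L0] := eqVneq L set0.
  exists setT, set0; rewrite L0 setI0.
  by split=> //; [exact: openT|exact: open0].
pose QK := Qstar_point cK K0; pose QL := Qstar_point cL L0.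
have oQW : open (set_val @^-1` Qbox W : set (Qvstar X)).
  by exists (Qbox W) => //; exact: open_Qbox.
have [|C [D [oC oD KC LD CDW]]] := wHQ _ _ _ (compact_saturated_spec_le QK)
    (compact_saturated_spec_le QL) oQW.
  move=> M [/spec_le_Qvstar MK /spec_le_Qvstar ML] x Mx.
  by apply: KLW; split; [exact: MK|exact: ML].
have [U [oU KU UC]] := open_QvstarP oC (KC _ (spec_le_refl QK)).
have [V [oV LV VD]] := open_QvstarP oD (LD _ (spec_le_refl QL)).
exists U, V; split=> // x [Ux Vx].
apply/(Qstar_up_sub _ (saturated_open oW)); apply: CDW; split.
  exact/UC/(Qstar_up_sub _ (saturated_open oU)).
exact/VD/(Qstar_up_sub _ (saturated_open oV)).
Qed.

Theorem theorem3p6 (X : topologicalType) :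
  [<-> coherent X /\ weakly_Hausdorff X;
       coherent (Qv X) /\ weakly_Hausdorff (Qv X);
       coherent (Qvstar X) /\ weakly_Hausdorff (Qvstar X)].
Proof.
tfae.
- by move=> [cohX wHX]; split; [exact: coherent_Qv|exact: weakly_Hausdorff_Qv].
- move=> [cohQ wHQ]; have clQ := @closed_Qvstar X; split.
    exact: coherent_closed.
  exact: weakly_Hausdorff_closed.
- move=> [cohQ wHQ]; split; first exact: coherent_of_Qvstar.
  exact: weakly_Hausdorff_of_Qvstar.
Qed.
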